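(* Let $A,B\in\mathrm{PSL}(2,\mathbb{R})$, let $G=\langle A,B\rangle$, and assume that $\tau=\mathrm{tr}([A,B])\neq 2$. Applied to the trace triple $(\mathrm{tr}(A),\mathrm{tr}(B),\mathrm{tr}(AB))$, the Trace Minimization Algorithm (spelled out in the context) computes the trace triple $(\mathrm{tr}(U),\mathrm{tr}(V),\mathrm{tr}(UV))$ of a pair $(U,V)\in G^2$ which is Nielsen equivalent to $(A,B)$ and satisfies (a) $2<\mathrm{tr}(U)\le\mathrm{tr}(V)\le\mathrm{tr}(UV)\le\frac12\,\mathrm{tr}(U)\,\mathrm{tr}(V)$ in the case $\tau<2$, or (b) $0\le \mathrm{tr}(U)\le\mathrm{tr}(V)$ and $\mathrm{tr}(UV)<0$ in the case $\tau>2$. Moreover, in case (a) the resulting trace triple is uniquely determined by the stated condition.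
   Context: $\mathrm{PSL}(2,\mathbb{R})=\mathrm{SL}(2,\mathbb{R})/\{\pm I_2\}$; $[A,B]=ABA^{-1}B^{-1}$, whose trace is well defined. Representatives of $A,B$ in $\mathrm{SL}(2,\mathbb{R})$ are chosen with non-negative traces, and the trace of a word in $A,B,A^{-1},B^{-1}$ is the trace of the same word in these representatives. The trace triple of a pair $(U,V)\in G^2$ is $(\mathrm{tr}(U),\mathrm{tr}(V),\mathrm{tr}(UV))$; switching the representative of the first or second component switches two of the three signs. Pairs $(A,B)$ and $(C,D)$ are Nielsen equivalent if $(C,D)$ is obtained from $(A,B)$ by a finite sequence of transformations of the forms: $(A,B)\mapsto(B,A)$; $(A,B)\mapsto(A^{-1},B)$; $(A,B)\mapsto(A,BA)$. If $(U,V)$ has trace triple $(x,y,z)$, then the following Nielsen transformations have the following effects on the trace triple: (P1) $(U,V)\mapsto(V,U)$ gives $(y,x,z)$; (P2) $(U,V)\mapsto(U^{-1},UV)$ gives $(x,z,y)$; (P3) $(U,V)\mapsto(UV,V^{-1})$ gives $(z,y,x)$; (M1) $(U,V)\mapsto(U,U^{-1}V)$ gives $(x,xy-z,y)$; (M2) $(U,V)\mapsto(UV^{-1},V)$ gives $(xy-z,y,x)$. Trace Minimization Algorithm. Input: a trace triple $(\mathrm{tr}(A),\mathrm{tr}(B),\mathrm{tr}(AB))$ of a pair $(A,B)\in\mathrm{PSL}(2,\mathbb{R})^2$ such that $\tau=\mathrm{tr}([A,B])\ne 2$. Step 1: Compute $\tau=\mathrm{tr}(A)^2+\mathrm{tr}(B)^2+\mathrm{tr}(AB)^2-\mathrm{tr}(A)\,\mathrm{tr}(B)\,\mathrm{tr}(AB)-2$.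 Step 2: Using (P1), (P2), (P3), permute the given trace triple (and, if necessary, switch two of the three signs) to get a triple $(x,y,z)$ which satisfies $2<x\le y\le|z|$ in case $\tau<2$ and $0\le x\le y\le|z|$ in case $\tau>2$. Step 3: Repeat the following: using (M1), (M2), compute a triple $(x',y',z')$ which satisfies $x'=xy-z\le y'=x\le z'=y$ or $x'=x\le y'=xy-z\le z'=y$ (in each further iteration the triple just computed plays the role of $(x,y,z)$); until $z'\le\frac12x'y'$ in the case $\tau<2$, or $x'<0$ in the case $\tau>2$. (This is a repeat-until loop: the stopping condition is tested after the body.) Step 4: Return $(x',y',z')$ in the case $\tau<2$, and $(y',z',x')$ in the case $\tau>2$.
   Formalization: Step 3 as printed cannot be executed when xy−z > y (e.g. on the trace triple (3,3,3), or (3,10,16)); the formal algorithm also allows the ordering x'=x ≤ y'=y ≤ z'=xy−z, with everything else unchanged. *)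

(* Defs.v *)
From HB Require Import structures.
From Stdlib Require Import Relation_Operators.
From mathcomp Require Import all_boot all_order all_algebra.
From mathcomp Require Import generic_quotient reals.

Set Implicit Arguments.
Unset Strict Implicit.
Unset Printing Implicit Defensive.

Import Order.TTheory GRing.Theory Num.Theory.

Local Open Scope ring_scope.
Local Open Scope quotient_scope.

Record SL2 (R : realType) : Type := MkSL2 {
  sl2_mx :> 'M[R]_2;
  sl2_det : \det sl2_mx == 1
}.

HB.instance Definition _ (R : realType) := [isSub for @sl2_mx R].
HB.instance Definition _ (R : realType) := [Choice of SL2 R by <:].

Section SL2Group.
Variable R : realType.
Implicit Types a b : SL2 R.

Fact sl2_unit a : (a : 'M[R]_2) \is a GRing.unit.
Proof. by rewrite -[_ \is a _]/(_ \in unitmx) unitmxE (eqP (sl2_det a)) unitr1. Qed.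

Fact sl2_one_det : \det (1 : 'M[R]_2) == 1.
Proof. by rewrite det1. Qed.

Fact sl2_mul_det a b : \det ((a : 'M[R]_2) * b) == 1.
Proof. by rewrite det_mulmx (eqP (sl2_det a)) (eqP (sl2_det b)) mul1r. Qed.

Fact sl2_inv_det a : \det ((a : 'M[R]_2)^-1) == 1.
Proof. by rewrite det_inv (eqP (sl2_det a)) invr1. Qed.

Fact sl2_opp_det a : \det (- (a : 'M[R]_2)) == 1.
Proof. by rewrite -scaleN1r detZ sqrrN expr1n mul1r sl2_det. Qed.

Definition sl2_one : SL2 R := MkSL2 sl2_one_det.
Definition sl2_mul a b : SL2 R := MkSL2 (sl2_mul_det a b).
Definition sl2_inv a : SL2 R := MkSL2 (sl2_inv_det a).
Definition sl2_opp a : SL2 R := MkSL2 (sl2_opp_det a).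

Fact sl2_mulA : associative sl2_mul.
Proof. by move=> a b c; apply: val_inj; rewrite /= mulrA. Qed.

Fact sl2_mul1 : left_id sl2_one sl2_mul.
Proof. by move=> a; apply: val_inj; rewrite /= mul1r. Qed.

Fact sl2_mulr1 : right_id sl2_one sl2_mul.
Proof. by move=> a; apply: val_inj; rewrite /= mulr1. Qed.

Fact sl2_mulV : left_inverse sl2_one sl2_inv sl2_mul.
Proof. by move=> a; apply: val_inj; rewrite /= mulVr ?sl2_unit. Qed.

Fact sl2_mulrV : right_inverse sl2_one sl2_inv sl2_mul.
Proof. by move=> a; apply: val_inj; rewrite /= mulrV ?sl2_unit. Qed.

HB.instance Definition _ :=
  isGroup.Build (SL2 R) sl2_mulA sl2_mul1 sl2_mulr1 sl2_mulV sl2_mulrV.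

Definition pm_eq a b := (a == b) || (a == sl2_opp b).

Fact sl2_oppK : involutive sl2_opp.
Proof. by move=> a; apply: val_inj; rewrite /= opprK. Qed.

Fact pm_eq_refl : reflexive pm_eq.
Proof. by move=> a; rewrite /pm_eq eqxx. Qed.

Fact pm_eq_sym : symmetric pm_eq.
Proof.
by move=> a b; rewrite /pm_eq (eq_sym b a) (eq_sym b) (can2_eq sl2_oppK sl2_oppK).
Qed.

Fact pm_eq_trans : transitive pm_eq.
Proof.
move=> b a c /orP[]/eqP-> // /orP[]/eqP->; rewrite /pm_eq ?sl2_oppK eqxx ?orbT //.
Qed.

Canonical pm_equiv := EquivRel pm_eq pm_eq_refl pm_eq_sym pm_eq_trans.

End SL2Group.

Definition PSL2 (R : realType) : Type := {eq_quot (pm_equiv R)}.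

HB.instance Definition _ (R : realType) := Choice.on (PSL2 R).
HB.instance Definition _ (R : realType) := EqQuotient.on (PSL2 R).

Section PSL2Group.
Variable R : realType.
Implicit Types A B : PSL2 R.

Definition psl2_one : PSL2 R := \pi_(PSL2 R) 1%g.
Definition psl2_mul := lift_op2 (PSL2 R) (fun a b : SL2 R => (a * b)%g).
Definition psl2_inv := lift_op1 (PSL2 R) (fun a : SL2 R => a^-1%g).

Fact pi_psl2_mul :
  {morph \pi_(PSL2 R) : a b / (a * b)%g >-> psl2_mul a b}.
Proof.
move=> a b; unlock psl2_mul; apply/eqmodP.
have /eqmodP := reprK (\pi_(PSL2 R) a); have /eqmodP := reprK (\pi_(PSL2 R) b).
move=> /orP[]/eqP-> /orP[]/eqP->; rewrite /= /pm_eq.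
- by rewrite eqxx.
- by apply/orP; right; apply/eqP/val_inj; rewrite /= mulNr opprK.
- by apply/orP; right; apply/eqP/val_inj; rewrite /= mulrN opprK.
- by apply/orP; left; apply/eqP/val_inj; rewrite /= mulrNN.
Qed.

Fact pi_psl2_inv : {morph \pi_(PSL2 R) : a / a^-1%g >-> psl2_inv a}.
Proof.
move=> a; unlock psl2_inv; apply/eqmodP.
have /eqmodP := reprK (\pi_(PSL2 R) a).
move=> /orP[]/eqP->; rewrite /= /pm_eq ?eqxx //.
by apply/orP; right; apply/eqP/val_inj; rewrite /= invrN opprK.
Qed.

Fact psl2_mulA : associative psl2_mul.
Proof.
elim/quotW=> a; elim/quotW=> b; elim/quotW=> c.
by rewrite -!pi_psl2_mul mulgA.
Qed.

Fact psl2_mul1 : left_id psl2_one psl2_mul.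
Proof. by elim/quotW=> a; rewrite -pi_psl2_mul mul1g. Qed.

Fact psl2_mulr1 : right_id psl2_one psl2_mul.
Proof. by elim/quotW=> a; rewrite -pi_psl2_mul mulg1. Qed.

Fact psl2_mulV : left_inverse psl2_one psl2_inv psl2_mul.
Proof. by elim/quotW=> a; rewrite -pi_psl2_inv -pi_psl2_mul mulVg. Qed.

Fact psl2_mulrV : right_inverse psl2_one psl2_inv psl2_mul.
Proof. by elim/quotW=> a; rewrite -pi_psl2_inv -pi_psl2_mul mulgV. Qed.

HB.instance Definition _ :=
  isGroup.Build (PSL2 R) psl2_mulA psl2_mul1 psl2_mulr1 psl2_mulV psl2_mulrV.

End PSL2Group.

Section Nielsen.
Variable G : groupType.
Implicit Types (g h : G) (p : G * G).

Inductive generated (g h : G) : G -> Prop :=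
| generated_l : generated g h g
| generated_r : generated g h h
| generated_1 : generated g h 1%g
| generated_M u v : generated g h u -> generated g h v -> generated g h (u * v)%g
| generated_V u : generated g h u -> generated g h u^-1%g.

Inductive nielsen_move : G * G -> G * G -> Prop :=
| nielsen_swap g h : nielsen_move (g, h) (h, g)
| nielsen_inv g h : nielsen_move (g, h) (g^-1%g, h)
| nielsen_mul g h : nielsen_move (g, h) (g, (h * g)%g).

Definition nielsen : G * G -> G * G -> Prop := clos_refl_trans _ nielsen_move.

End Nielsen.

Section Traces.
Variable R : realType.
Implicit Types (U V : PSL2 R) (u v : SL2 R).

Definition tr u : R := \tr (u : 'M[R]_2).

Definition traces u v : R * R * R := (tr u, tr v, tr (u * v)%g).

(* The traces of U and V are defined up to sign; changing the sign of one
   representative changes two of the three signs of the triple, and every such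
   choice is a trace triple of (U, V). *)
Definition trace_triple U V (t : R * R * R) : Prop :=
  exists u v, [/\ \pi_(PSL2 R) u = U, \pi_(PSL2 R) v = V & traces u v = t].

End Traces.

Section TraceMinimization.
Variable R : realType.
Implicit Types (tau : R) (s t : R * R * R).

Definition tau_of s : R :=
  let: (x, y, z) := s in x ^+ 2 + y ^+ 2 + z ^+ 2 - x * y * z - 2.

Inductive arrange_move : R * R * R -> R * R * R -> Prop :=
| arrange_P1 x y z : arrange_move (x, y, z) (y, x, z)
| arrange_P2 x y z : arrange_move (x, y, z) (x, z, y)
| arrange_P3 x y z : arrange_move (x, y, z) (z, y, x)
| arrange_sign12 x y z : arrange_move (x, y, z) (- x, - y, z)
| arrange_sign13 x y z : arrange_move (x, y, z) (- x, y, - z)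
| arrange_sign23 x y z : arrange_move (x, y, z) (x, - y, - z).

Definition arranged tau t : bool :=
  let: (x, y, z) := t in
  [&& (if tau < 2 then 2 < x else 0 <= x), x <= y & y <= `|z|].

Definition step2 tau s t : Prop :=
  clos_refl_trans _ arrange_move s t /\ arranged tau t.

(* The loop body replaces z by x * y - z and sorts.  The third ordering has to
   be allowed: without it the body cannot be executed on (3, 10, 16), where
   x * y - z = 14, nor on most triples that are already minimal, such as
   (3, 3, 3).  When x * y - z <= y it only applies to x * y - z = y, where it
   agrees with the second one. *)
Inductive loop_body : R * R * R -> R * R * R -> Prop :=
| body_first x y z :
    x * y - z <= x -> x <= y -> loop_body (x, y, z) (x * y - z, x, y)
| body_second x y z :
    x <= x * y - z -> x * y - z <= y -> loop_body (x, y, z) (x, x * y - z, y)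
| body_third x y z :
    x <= y -> y <= x * y - z -> loop_body (x, y, z) (x, y, x * y - z).

Definition loop_stop tau t : bool :=
  let: (x, y, z) := t in if tau < 2 then z <= x * y / 2 else x < 0.

Inductive loop_returns tau : R * R * R -> R * R * R -> Prop :=
| loop_exit s t : loop_body s t -> loop_stop tau t -> loop_returns tau s t
| loop_again s s' t :
    loop_body s s' -> ~~ loop_stop tau s' -> loop_returns tau s' t ->
    loop_returns tau s t.

(* Started from s, the loop neither blocks nor runs forever, whatever choices
   are made in its body. *)
Inductive loop_terminates tau : R * R * R -> Prop :=
| LoopTerminates s :
    (exists s', loop_body s s') ->
    (forall s', loop_body s s' -> ~~ loop_stop tau s' ->
       loop_terminates tau s') ->
    loop_terminates tau s.

Definition step4 tau t : R * R * R :=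
  let: (x, y, z) := t in if tau < 2 then (x, y, z) else (y, z, x).

Definition tma_returns s t : Prop :=
  exists s' t', [/\ step2 (tau_of s) s s', loop_returns (tau_of s) s' t'
                  & t = step4 (tau_of s) t'].

Definition tma_terminates s : Prop :=
  (exists s', step2 (tau_of s) s s') /\
  (forall s', step2 (tau_of s) s s' -> loop_terminates (tau_of s) s').

Definition minimal_a t : bool :=
  let: (x, y, z) := t in [&& 2 < x, x <= y, y <= z & z <= x * y / 2].

Definition minimal_b t : bool :=
  let: (x, y, z) := t in [&& 0 <= x, x <= y & z < 0].

End TraceMinimization.

(* Main.v *)
(* The quantity [tau_of] is invariant, so a flip [z |-> x * y - z] exchanges the
   two roots of a quadratic polynomial.  Termination: the gap between the roots
   is bounded below along the run (for [tau < 2] because the discriminant keeps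
   [x] away from 2), so the sum of the triple decreases by a fixed amount.
   Uniqueness: when [tau < 2], start from a minimal triple [m] and only allow
   permutations and non-decreasing flips.  The set obtained is already closed
   under all flips, hence contains all positive trace triples of the Nielsen
   class, and its last non-decreasing flip shows that a reduced element of it
   is a permutation of [m]. *)
Require Import Defs.
From Stdlib Require Import Relation_Operators.
From mathcomp Require Import all_boot all_order all_algebra.
From mathcomp Require Import generic_quotient reals ring lra.

Set Implicit Arguments.
Unset Strict Implicit.
Unset Printing Implicit Defensive.

Import Order.TTheory GRing.Theory Num.Theory.

Local Open Scope ring_scope.
Local Open Scope quotient_scope.

(** * Trace identities in SL(2,R), and hyperbolicity when [tau < 2] *)

Section TraceIdentities.
Variable R : realType.
Implicit Types u v : SL2 R.

Lemma trE u : tr u = u 0 0 + u 1 1.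
Proof. by rewrite /tr /mxtrace big_ord_recl big_ord1; congr (_ + u _ _); apply: val_inj. Qed.

Lemma mul2E u v i j : (u * v)%g i j = u i 0 * v 0 j + u i 1 * v 1 j.
Proof.
rewrite [LHS]mxE big_ord_recl big_ord1.
by congr (_ + u _ _ * v _ _); apply: val_inj.
Qed.

(** A single monomial stands on the left so that [ring] can use the equation as a rewriting rule. *)
Lemma sl2_detE u : u 0 0 * u 1 1 = 1 + u 0 1 * u 1 0.
Proof.
rewrite -(eqP (sl2_det u)) (expand_det_row _ 0) big_ord_recl big_ord1.
rewrite /cofactor !det_mx11 !mxE /= expr0 expr1.
have -> : lift 0 0 = 1 :> 'I_2 by apply: val_inj.
have -> : lift 1 0 = 0 :> 'I_2 by apply: val_inj.
by ring.
Qed.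

Lemma trC u v : tr (u * v)%g = tr (v * u)%g.
Proof. exact: mxtrace_mulC. Qed.

Lemma tr1 : tr (1%g : SL2 R) = 2.
Proof. by rewrite /tr /= mxtrace1. Qed.

Lemma tr_opp u : tr (sl2_opp u) = - tr u.
Proof. exact: raddfN. Qed.

(** Cayley-Hamilton, [u ^+ 2 = tr u * u - 1], multiplied by [v]. *)
Lemma tr_sqr_mul u v : tr (u * (u * v))%g = tr u * tr (u * v)%g - tr v.
Proof. by have := sl2_detE u; rewrite !trE !mul2E => h; ring: h. Qed.

Lemma tr_mulVl u v : tr (u^-1 * v)%g = tr u * tr v - tr (u * v)%g.
Proof. by have := tr_sqr_mul u (u^-1 * v)%g; rewrite !mulVKg => ->; ring. Qed.

Lemma tr_inv u : tr u^-1%g = tr u.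
Proof. by have := tr_mulVl u 1%g; rewrite !mulg1 tr1 => ->; ring. Qed.

Lemma tr_mulVr u v : tr (u * v^-1)%g = tr u * tr v - tr (u * v)%g.
Proof. by rewrite trC tr_mulVl mulrC (trC v). Qed.

Lemma tr_conj u v : tr (u * v * u^-1)%g = tr v.
Proof. by rewrite trC mulKg. Qed.

(** Fricke's identity: it identifies the number computed in Step 1 with the trace of the
    commutator. *)
Lemma tr_commutator u v : tr (u * v * u^-1 * v^-1)%g = tau_of (traces u v).
Proof.
rewrite tr_mulVr tr_conj -[in X in _ - tr X]mulgA.
have -> : (u^-1 * v = (v^-1 * u)^-1)%g by rewrite invgM invgK.
rewrite tr_mulVr tr_mulVl -(mulgA u) mulVKg (trC v u).
have := tr_sqr_mul u 1%g; rewrite !mulg1 tr1 => ->.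
by rewrite /tau_of /traces; ring.
Qed.

(* [2 - tau] is [det (uv - vu)].  The commutator [uv - vu] is orthogonal to the
   traceless part of [u] for the form [det], of signature (1, 2) on traceless
   matrices, so it cannot have positive determinant when [u] is not hyperbolic. *)
Lemma hyperbolic_of_tau_lt2 u v : tau_of (traces u v) < 2 -> 2 < `|tr u|.
Proof.
rewrite /tau_of /traces !trE !mul2E.
have := sl2_detE u; have := sl2_detE v.
move: (u 0 0) (u 0 1) (u 1 0) (u 1 1) (v 0 0) (v 0 1) (v 1 0) (v 1 1).
move=> a b c d p q r s hv hu ht.
pose e := a - d.
(* The matrix [uv - vu] has diagonal [w1], [- w1] and off-diagonal entries [w2], [w3]. *)
pose w1 := b * r - q * c; pose w2 := q * e - b * (p - s).
pose w3 := c * (p - s) - r * e.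
have hdet : 0 < - w1 ^+ 2 - w2 * w3.
  rewrite (_ : - w1 ^+ 2 - w2 * w3 = 4 - ((a + d) ^+ 2 + (p + s) ^+ 2 +
    (a * p + b * r + (c * q + d * s)) ^+ 2 -
    (a + d) * (p + s) * (a * p + b * r + (c * q + d * s)))); first by lra.
  by rewrite /w1 /w2 /w3 /e; ring: hu hv.
have horth : b * w3 = - (e * w1) - c * w2 by rewrite /w1 /w2 /w3; ring.
rewrite ltNge; apply/negP => hle.
have hle2 : (a + d) ^+ 2 <= 4.
  by rewrite -real_normK ?num_real //; have := normr_ge0 (a + d); nra.
have hdisc : e ^+ 2 + 4 * b * c <= 0 by rewrite /e; nra.
(* Orthogonality eliminates [w3]. As the discriminant [e ^+ 2 + 4 * b * c] of [u] is at most 0, the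
   right-hand side is nonnegative, against [hdet] unless [b = 0]. *)
have hb : 4 * b ^+ 2 * (w1 ^+ 2 + w2 * w3) =
  (2 * b * w1 - e * w2) ^+ 2 - (e ^+ 2 + 4 * b * c) * w2 ^+ 2.
  by transitivity (4 * b * (b * w1 ^+ 2 + w2 * (b * w3))); [|rewrite horth]; ring.
have [b0|b0] := eqVneq b 0.
  have e0 : e = 0.
    by apply/eqP; rewrite -sqrf_eq0 eq_le sqr_ge0 andbT; rewrite b0 in hdisc; lra.
  have : w1 ^+ 2 = (q * c) ^+ 2 by rewrite /w1 b0; ring.
  have : w2 = 0 by rewrite /w2 b0 e0; ring.
  by move=> h1 h2; move: hdet; rewrite h1 h2; have := sqr_ge0 (q * c); lra.
have : 0 < b ^+ 2 by rewrite lt_neqAle sqr_ge0 eq_sym sqrf_eq0 b0.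
have := sqr_ge0 (2 * b * w1 - e * w2); have := sqr_ge0 w2.
nra.
Qed.

End TraceIdentities.

(** * Nielsen equivalence in an arbitrary group *)

Section NielsenEquivalence.
Variable G : groupType.
Implicit Types (g h : G) (p q : G * G).

Lemma nielsen_trans p q r : nielsen p q -> nielsen q r -> nielsen p r.
Proof. exact: rt_trans. Qed.

Lemma nielsen_of_move p q : nielsen_move p q -> nielsen p q.
Proof. exact: rt_step. Qed.

Lemma nielsenC g h : nielsen (g, h) (h, g).
Proof. exact/nielsen_of_move/nielsen_swap. Qed.

Lemma nielsenVl g h : nielsen (g, h) (g^-1%g, h).
Proof. exact/nielsen_of_move/nielsen_inv. Qed.

Lemma nielsenVr g h : nielsen (g, h) (g, h^-1%g).
Proof.
apply: nielsen_trans (nielsenC g h) _; apply: nielsen_trans (nielsenVl h g) _.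
exact: nielsenC.
Qed.

Lemma nielsenM g h : nielsen (g, h) (g, (h * g)%g).
Proof. exact/nielsen_of_move/nielsen_mul. Qed.

Lemma nielsenMV g h : nielsen (g, h) (g, (h * g^-1)%g).
Proof.
apply: nielsen_trans (nielsenVl g h) _.
by apply: nielsen_trans (nielsenM _ _) _; have := nielsenVl g^-1%g (h * g^-1)%g; rewrite invgK.
Qed.

Lemma nielsenMl g h : nielsen (g, h) (g, (g * h)%g).
Proof.
apply: nielsen_trans (nielsenVr g h) _; apply: nielsen_trans (nielsenMV _ _) _.
by have := nielsenVr g (h^-1 * g^-1)%g; rewrite invgM !invgK.
Qed.

Lemma nielsenMVl g h : nielsen (g, h) (g, (g^-1 * h)%g).
Proof.
apply: nielsen_trans (nielsenVr g h) _; apply: nielsen_trans (nielsenM _ _) _.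
by have := nielsenVr g (h^-1 * g)%g; rewrite invgM !invgK.
Qed.

Lemma nielsen_sym p q : nielsen p q -> nielsen q p.
Proof.
elim=> [_ _ [g h|g h|g h]|?|? ? ? _ h1 _ h2].
- exact: nielsenC.
- by have := nielsenVl g^-1%g h; rewrite invgK.
- by have := nielsenMV g (h * g)%g; rewrite mulgK.
- exact: rt_refl.
- exact: nielsen_trans h2 h1.
Qed.

Lemma nielsen_generated g h p q : nielsen p q ->
  generated g h p.1 /\ generated g h p.2 -> generated g h q.1 /\ generated g h q.2.
Proof.
elim=> [_ _ [a b|a b|a b] [/= ? ?]|//|? ? ? _ h1 _ h2 /h1/h2//]; split=> //.
- exact: generated_V.
- exact: generated_M.
Qed.

End NielsenEquivalence.

(** * Triples realized in a Nielsen class, and invariance of [tau_of] *)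

Section RealizedTriples.
Variable R : realType.
Implicit Types (u v : SL2 R) (A B U V : PSL2 R) (s t : R * R * R).

Lemma pi_opp u : \pi_(PSL2 R) (sl2_opp u) = \pi_(PSL2 R) u.
Proof. by apply/eqmodP; rewrite /= /pm_eq eqxx orbT. Qed.

Lemma pi_eq_tr_gt0 u v :
  \pi_(PSL2 R) u = \pi_(PSL2 R) v -> 0 < tr u -> 0 < tr v -> u = v.
Proof.
move=> /eqmodP/orP[]/eqP -> //.
by rewrite tr_opp oppr_gt0 => hlt /lt_trans/(_ hlt); rewrite ltxx.
Qed.

Lemma sl2_mulN u v : (u * sl2_opp v)%g = sl2_opp (u * v)%g.
Proof. by apply: val_inj; rewrite /= mulrN. Qed.

(** The invariant carried through all steps of the algorithm. It quantifies over lifts to SL(2,R),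
    so that a sign switch is a change of lift. *)
Definition realized A B t :=
  exists u v, nielsen (A, B) (\pi_(PSL2 R) u, \pi_(PSL2 R) v) /\ traces u v = t.

Section Closure.
Variables A B : PSL2 R.

Lemma realized_P1 x y z : realized A B (x, y, z) -> realized A B (y, x, z).
Proof.
move=> [u [v [hn [<- <- <-]]]]; exists v, u; rewrite /traces trC; split=> //.
exact: nielsen_trans hn (nielsenC _ _).
Qed.

Lemma realized_P2 x y z : realized A B (x, y, z) -> realized A B (x, z, y).
Proof.
move=> [u [v [hn [<- <- <-]]]]; exists u^-1%g, (u * v)%g.
rewrite /traces tr_inv mulKg pi_psl2_mul pi_psl2_inv; split=> //.
apply: nielsen_trans hn _; apply: nielsen_trans (nielsenMl _ _) _.
exact: nielsenVl.
Qed.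

Lemma realized_M1 x y z :
  realized A B (x, y, z) -> realized A B (x, x * y - z, y).
Proof.
move=> [u [v [hn [<- <- <-]]]]; exists u, (u^-1 * v)%g.
rewrite /traces tr_mulVl mulVKg pi_psl2_mul pi_psl2_inv; split=> //.
exact: nielsen_trans hn (nielsenMVl _ _).
Qed.

Lemma realized_sign23 x y z : realized A B (x, y, z) -> realized A B (x, - y, - z).
Proof.
move=> [u [v [hn [<- <- <-]]]]; exists u, (sl2_opp v).
by rewrite /traces sl2_mulN !tr_opp pi_opp.
Qed.

Lemma realized_sign13 x y z : realized A B (x, y, z) -> realized A B (- x, y, - z).
Proof. by move=> /realized_P1/realized_sign23/realized_P1. Qed.

Lemma realized_sign12 x y z : realized A B (x, y, z) -> realized A B (- x, - y, z).
Proof. by move=> /realized_P2/realized_sign13/realized_P2. Qed.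

Lemma realized_arrange s t : arrange_move s t -> realized A B s -> realized A B t.
Proof.
case=> x y z.
- exact: realized_P1.
- exact: realized_P2.
- by move=> /realized_P1/realized_P2/realized_P1.
- exact: realized_sign12.
- exact: realized_sign13.
- exact: realized_sign23.
Qed.

Lemma realized_step2 tau s t : step2 tau s t -> realized A B s -> realized A B t.
Proof.
case=> hst _; elim: hst => [? ?|//|? ? ? _ h1 _ h2 /h1/h2//].
exact: realized_arrange.
Qed.

Lemma realized_loop_body s t : loop_body s t -> realized A B s -> realized A B t.
Proof.
case=> x y z _ _ /realized_M1 h; last exact: realized_P2.
- exact/realized_P1.
- exact: h.
Qed.

Lemma realized_loop tau s t : loop_returns tau s t -> realized A B s -> realized A B t.
Proof.
elim=> [s1 t1 /realized_loop_body h _ //|s1 s2 t1 /realized_loop_body h _ _ IH /h].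
exact: IH.
Qed.

Lemma realized_step4 tau t : realized A B t -> realized A B (step4 tau t).
Proof.
case: t => [[x y] z]; rewrite /step4; case: ifP => // _.
by move=> /realized_P1/realized_P2.
Qed.

End Closure.

Lemma tau_arrange s t : arrange_move s t -> tau_of t = tau_of s.
Proof. by case=> x y z; rewrite /tau_of; ring. Qed.

Lemma tau_step2 tau s t : step2 tau s t -> tau_of t = tau_of s.
Proof.
case=> hst _; elim: hst => [? ? /tau_arrange//|//|? ? ? _ h1 _ h2].
by rewrite h2.
Qed.

Lemma tau_loop_body s t : loop_body s t -> tau_of t = tau_of s.
Proof. by case=> x y z _ _; rewrite /tau_of; ring. Qed.

End RealizedTriples.

(** * Order invariants and partial correctness of the loop *)

Section Triples.
Variable R : realType.
Implicit Types (x y z tau : R) (s t : R * R * R).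

Definition sorted3 t := let: (x, y, z) := t in (x <= y) && (y <= z).

Definition gt2 t := let: (x, y, z) := t in [&& 2 < x, 2 < y & 2 < z].

Lemma loop_body_sorted s t : loop_body s t -> sorted3 t.
Proof. by case=> x y z /= -> ->. Qed.

(* [z] and [x * y - z] are the roots of a quadratic polynomial whose value at
   [2] is [(x - y) ^+ 2 + (2 - tau)]. *)
Lemma flip_gt2 x y z : tau_of (x, y, z) < 2 -> 2 < x -> 2 < y -> 2 < z ->
  2 < x * y - z.
Proof.
rewrite /tau_of => ht hx hy hz; rewrite -subr_gt0.
rewrite -(pmulr_rgt0 _ (_ : 0 < z - 2)) ?subr_gt0 //.
by have := sqr_ge0 (x - y); nra.
Qed.

Lemma loop_body_gt2 s t : loop_body s t -> tau_of s < 2 -> gt2 s -> gt2 t.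
Proof.
by case=> x y z _ _ /flip_gt2 h /and3P[hx hy hz]; rewrite /gt2 hx hy ?hz h.
Qed.

Lemma loop_returns_minimal_a tau s t : loop_returns tau s t ->
  tau < 2 -> tau_of s = tau -> gt2 s -> minimal_a t.
Proof.
move=> h ht; elim: h => {s t} [s t hb hstop|s s' t hb _ _ IH] hs h2; last first.
  by apply: IH; [rewrite (tau_loop_body hb)|apply: (loop_body_gt2 hb); rewrite ?hs].
have := loop_body_gt2 hb; rewrite hs => /(_ ht h2).
have := loop_body_sorted hb.
case: t {hb} hstop => [[x y] z]; rewrite /loop_stop ht /=.
by move=> -> /andP[-> ->] /and3P[-> _ _].
Qed.

(** The two entries that are kept are nonnegative, so the loop can only stop on a negative flipped
    entry, which [step4] moves to the last place. *)
Lemma loop_returns_minimal_b tau s t : loop_returns tau s t -> ~~ (tau < 2) ->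
  (let: (x, y, z) := s in (0 <= x) && (x <= y)) -> minimal_b (step4 tau t).
Proof.
move=> h ht; elim: h => {s t} [s t hb hstop|s s' t hb hstop _ IH] hs; last first.
  apply: IH; have := loop_body_sorted hb.
  case: s' {hb} hstop => [[x y] z] /=; rewrite (negbTE ht) -leNgt => ->.
  by case/andP.
by case: hb hs hstop => x y z _ _ /= /andP[h3 h4]; rewrite (negbTE ht) /= ?h3 ?h4 //;
  rewrite ltNge h3.
Qed.

Lemma loop_body_exists x y z : x <= y -> exists t, loop_body (x, y, z) t.
Proof.
move=> hxy; have [h1|h1] := lerP (x * y - z) x.
  by exists (x * y - z, x, y); apply: body_first.
have [h2|h2] := lerP (x * y - z) y.
  by exists (x, x * y - z, y); apply: body_second => //; apply: ltW.
by exists (x, y, x * y - z); apply: body_third => //; apply: ltW.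
Qed.

End Triples.

(** * Termination of the loop *)

Section Termination.
Variable R : realType.
Implicit Types (x y z tau : R) (s t : R * R * R).

(** Archimedean descent on the sum of the entries. The left disjunct lets a run leave [P] once its
    termination is known otherwise. *)
Lemma loop_terminates_descent tau (P : R * R * R -> Prop) (d : R) : 0 < d ->
  (forall s, P s -> exists t, loop_body s t) ->
  (forall x y z, P (x, y, z) -> 0 <= x + y + z) ->
  (forall x y z x' y' z', P (x, y, z) -> loop_body (x, y, z) (x', y', z') ->
     ~~ loop_stop tau (x', y', z') ->
     loop_terminates tau (x', y', z') \/
     P (x', y', z') /\ x' + y' + z' + d <= x + y + z) ->
  forall s, P s -> loop_terminates tau s.
Proof.
move=> d0 hex hpos hstep [[x y] z] hP.
have [n] : exists n : nat, x + y + z < n%:R * d.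
  exists (Num.Def.archi_bound ((x + y + z) / d)).
  by rewrite -ltr_pdivrMr // archi_boundP // divr_ge0 ?hpos // ltW.
elim: n x y z hP => [|n IH] x y z hP hn.
  by have := hpos _ _ _ hP; rewrite leNgt -(mul0r d) hn.
apply: LoopTerminates => [|[[x' y'] z'] hb hstop]; first exact: hex.
have [//|[hP' hle]] := hstep _ _ _ _ _ _ hP hb hstop.
by apply: IH => //; move: hn; rewrite -natr1 mulrDl mul1r; lra.
Qed.

(* The discriminant [(z - (x * y - z)) ^+ 2] of the quadratic polynomial with
   roots [z] and [x * y - z], corrected by its value at [y]: the left-hand side
   is at most [(z - (x * y - z)) ^+ 2] as soon as [y] lies between the roots. *)
Lemma flip_gap x y z c : 0 <= x -> x * y - z <= y -> y <= z -> 0 <= c ->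
  c <= (x - 2) * (x ^+ 2 - 2 - tau_of (x, y, z)) ->
  x * y - z + Num.sqrt c <= z.
Proof.
rewrite /tau_of => hx hf hy hc hle.
have hsq : c <= (z - (x * y - z)) ^+ 2.
  (* The weight [x + 2] cancels [y ^+ 2] between the discriminant and the value at [y]. *)
  have : (x + 2) * ((y - z) * (y - (x * y - z))) <= 0.
    by rewrite mulr_ge0_le0 //; [lra | rewrite mulr_le0_ge0 // subr_cp0].
  by nra.
have hd : 0 <= z - (x * y - z) by lra.
have : Num.sqrt c <= z - (x * y - z).
  by rewrite -(ger0_norm hd) -sqrtr_sqr ler_wsqrtr.
by lra.
Qed.

Lemma loop_terminates_tau_lt2 x y z tau : tau < 2 -> tau_of (x, y, z) = tau ->
  2 < x -> x <= y -> y <= z -> loop_terminates tau (x, y, z).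
Proof.
move=> ht htau hx hxy hyz; pose M := z.
(* The discriminant equals [(x ^+ 2 - 4) * (y ^+ 2 - 4) - 4 * (2 - tau)] and is nonnegative. With
   all entries at most [M] this gives [eta <= x - 2]. *)
pose eta := 4 * (2 - tau) / ((M + 2) * (M ^+ 2 - 4)).
have hM : 0 < (M + 2) * (M ^+ 2 - 4) by rewrite /M; apply: mulr_gt0; nra.
have eta0 : 0 < eta by rewrite divr_gt0 // mulr_gt0 //; lra.
pose P s := let: (x, y, z) := s in
  [/\ tau_of s = tau, 2 < x, x <= y, y <= z & z <= M].
have Peta x1 y1 z1 : P (x1, y1, z1) -> eta <= x1 - 2.
  case; rewrite /tau_of => h1 h2 h3 h4 h5; rewrite ler_pdivrMr //.
  have h6 : 4 * (2 - tau) <= (x1 - 2) * ((x1 + 2) * (y1 ^+ 2 - 4)).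
    by have := sqr_ge0 (z1 - (x1 * y1 - z1)); nra.
  apply: le_trans h6 _; rewrite ler_wpM2l //; first by lra.
  by apply: ler_pM; nra.
have hd : 0 < Num.sqrt (eta * (2 - tau)).
  by rewrite sqrtr_gt0 mulr_gt0 // subr_gt0.
apply: (loop_terminates_descent (P := P) hd); last by split.
- by move=> [[x1 y1] z1] [_ _ h _ _]; apply: loop_body_exists.
- by move=> x1 y1 z1 [_ ? ? ? _]; lra.
- move=> x1 y1 z1 x' y' z' hP hb hstop.
  have heta := Peta _ _ _ hP; case: (hP) => h1 h2 h3 h4 h5.
  have hg := loop_body_gt2 hb; rewrite h1 /gt2 in hg.
  have {hg} /and3P[g1 g2 g3] : [&& 2 < x', 2 < y' & 2 < z'].
    by apply: hg => //; apply/and3P; split; lra.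
  have /andP[s1 s2] := loop_body_sorted hb.
  have ht' := tau_loop_body hb; rewrite h1 in ht'.
  have gap : x1 * y1 - z1 <= y1 -> x1 * y1 - z1 + Num.sqrt (eta * (2 - tau)) <= z1.
    move=> hf; apply: flip_gap => //; first by lra.
      by rewrite mulr_ge0 // ?(ltW eta0) //; lra.
    rewrite h1; apply: ler_pM => //; [exact: ltW | by lra | by nra].
  have hstop' : x' * y' / 2 < z' by move: hstop; rewrite /loop_stop ht -ltNge.
  inversion hb; subst.
  + by right; split; [split=> //; lra | have := gap ltac:(lra); lra].
  + by right; split; [split=> //; lra | have := gap ltac:(lra); lra].
  (* Flipping [z] back now gives a stopping triple. *)
  left; apply: LoopTerminates; first exact: loop_body_exists.
  move=> s' hb' /negP[]; rewrite /loop_stop ht.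
  by inversion hb'; subst; nra.
Qed.

Lemma loop_body_tau_gt2 x y z x' y' z' tau : 2 < tau -> tau_of (x, y, z) = tau ->
  loop_body (x, y, z) (x', y', z') -> ~~ loop_stop tau (x', y', z') ->
  [/\ tau_of (x', y', z') = tau, 0 <= x', x' <= y' & y' <= z'].
Proof.
move=> ht h hb; rewrite /loop_stop ltNge (ltW ht) -leNgt => hx.
by have /andP[? ?] := loop_body_sorted hb; split=> //; rewrite (tau_loop_body hb).
Qed.

(** If both roots were at least [y], the quadratic would be nonnegative at [y]; for [2 <= x] its
    value [(2 - x) * y ^+ 2 + x ^+ 2 - 2 - tau] is negative. For [x < 2] the triple would be zero,
    with [tau = -2]. *)
Lemma flip_lt_tau_gt2 x y z : 2 < tau_of (x, y, z) -> 0 <= x -> x <= y -> y <= z ->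
  x * y - z < y.
Proof.
rewrite /tau_of => ht hx hxy hyz; rewrite ltNge; apply/negP => hf.
have hval : 0 <= (y - z) * (y - (x * y - z)) by apply: mulr_le0; lra.
have [h2|h2] := leP 2 x.
  have : 0 <= (x - 2) * (y ^+ 2 - x - 2) by apply: mulr_ge0; nra.
  by nra.
have y0 : y = 0 by apply/eqP; rewrite eq_le; apply/andP; split; nra.
have x0 : x = 0 by lra.
have z0 : z = 0 by subst; lra.
by move: ht; rewrite x0 y0 z0; lra.
Qed.

(** The third ordering is excluded by [flip_lt_tau_gt2]. The gap comes from [flip_gap] or, for
    [2 <= x], from the discriminant [(x ^+ 2 - 4) * (y ^+ 2 - 4) + 4 * (tau - 2)]. *)
Lemma loop_decrease_tau_gt2 x y z x' y' z' tau c : 2 < tau -> tau_of (x, y, z) = tau ->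
  0 <= x -> x <= y -> y <= z -> 0 <= c ->
  c <= (x - 2) * (x ^+ 2 - 2 - tau) \/ 2 <= x /\ c <= 4 * (tau - 2) ->
  loop_body (x, y, z) (x', y', z') ->
  x' <= x /\ x' + y' + z' + Num.sqrt c <= x + y + z.
Proof.
move=> ht htau hx hxy hyz hc hcle hb.
have hf : x * y - z < y by apply: flip_lt_tau_gt2 => //; rewrite htau.
have gap : x * y - z + Num.sqrt c <= z.
  case: hcle => [hcle|[h2 hcle]].
    by apply: flip_gap => //; [exact: ltW | rewrite htau].
  have hsq : c <= (z - (x * y - z)) ^+ 2.
    have : 0 <= (x ^+ 2 - 4) * (y ^+ 2 - 4) by apply: mulr_ge0; nra.
    by move: hcle; rewrite -htau /tau_of; lra.
  have hd : 0 <= z - (x * y - z) by lra.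
  have : Num.sqrt c <= z - (x * y - z).
    by rewrite -(ger0_norm hd) -sqrtr_sqr ler_wsqrtr.
  by lra.
by inversion hb; subst; split; lra.
Qed.

Lemma loop_terminates_tau_gt2_small x y z tau : 2 < tau -> tau_of (x, y, z) = tau ->
  0 <= x -> x <= y -> y <= z -> x < 2 -> loop_terminates tau (x, y, z).
Proof.
(* First entries never increase, so they stay at most [x < 2], and [c] bounds
   [(2 - x1) * (tau + 2 - x1 ^+ 2)] from below throughout. *)
move=> ht htau hx hxy hyz hx2; pose c := (2 - x) * (tau - 2).
have hc : 0 < c by apply: mulr_gt0; lra.
pose P s := let: (x1, y1, z1) := s in
  [/\ tau_of s = tau, 0 <= x1, x1 <= y1, y1 <= z1 & x1 <= x].
have hd : 0 < Num.sqrt c by rewrite sqrtr_gt0.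
apply: (loop_terminates_descent (P := P) hd) => //.
- by move=> [[x1 y1] z1] [_ _ h _ _]; apply: loop_body_exists.
- by move=> x1 y1 z1 [_ ? ? ? _]; lra.
move=> x1 y1 z1 x' y' z' [h1 h2 h3 h4 h5] hb hstop; right.
have [g1 g2 g3 g4] := loop_body_tau_gt2 ht h1 hb hstop.
have [] := @loop_decrease_tau_gt2 x1 y1 z1 x' y' z' tau c => //; first exact: ltW.
  left; rewrite -mulrNN /c; apply: ler_pM; nra.
move=> k1 k2; split; last exact: k2.
by split; [exact: g1|exact: g2|exact: g3|exact: g4|exact: le_trans k1 h5].
Qed.

(** The descent runs while the first entry is at least 2; below 2 the previous lemma takes over. *)
Lemma loop_terminates_tau_gt2_sorted x y z tau : 2 < tau -> tau_of (x, y, z) = tau ->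
  0 <= x -> x <= y -> y <= z -> loop_terminates tau (x, y, z).
Proof.
move=> ht htau hx hxy hyz; pose c := 4 * (tau - 2).
have [hx2|hx2] := ltP x 2; first exact: loop_terminates_tau_gt2_small hx2.
have hc : 0 < c by rewrite /c; lra.
pose P s := let: (x1, y1, z1) := s in
  [/\ tau_of s = tau, 2 <= x1, x1 <= y1 & y1 <= z1].
have hd : 0 < Num.sqrt c by rewrite sqrtr_gt0.
apply: (loop_terminates_descent (P := P) hd) => //.
- by move=> [[x1 y1] z1] [_ _ h _]; apply: loop_body_exists.
- by move=> x1 y1 z1 [_ ? ? ?]; lra.
move=> x1 y1 z1 x' y' z' [h1 h2 h3 h4] hb hstop.
have [g1 g2 g3 g4] := loop_body_tau_gt2 ht h1 hb hstop.
have [hx'|hx'] := ltP x' 2; first by left; apply: loop_terminates_tau_gt2_small hx'.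
right; have [||k1 k2] := loop_decrease_tau_gt2 ht h1 _ h3 h4 (ltW hc) _ hb.
- by lra.
- by right; split.
- by split; [split; [exact: g1|exact: hx'|exact: g3|exact: g4]|exact: k2].
Qed.

(** Step 2 leaves the sign of [z] open; one pass through the body sorts the triple. *)
Lemma loop_terminates_tau_gt2 x y z tau : 2 < tau -> tau_of (x, y, z) = tau ->
  0 <= x -> x <= y -> loop_terminates tau (x, y, z).
Proof.
move=> ht htau hx hxy; apply: LoopTerminates; first exact: loop_body_exists.
move=> [[x' y'] z'] hb hstop.
by have [] := loop_body_tau_gt2 ht htau hb hstop; apply: loop_terminates_tau_gt2_sorted.
Qed.

End Termination.

(** * Uniqueness of the minimal triple for [tau < 2] *)

Section Uniqueness.
Variable R : realType.
Implicit Types (x y z : R) (s t m : R * R * R).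

Inductive ascends m : R -> R -> R -> Prop :=
| ascends_root : forall x y z, m = (x, y, z) -> ascends m x y z
| ascends_swap12 x y z : ascends m x y z -> ascends m y x z
| ascends_swap23 x y z : ascends m x y z -> ascends m x z y
| ascends_flip x y z :
    2 * z <= x * y -> ascends m x y z -> ascends m x y (x * y - z).

(** No flip makes an entry smaller; in contrast to [minimal_a], this is symmetric in the entries. *)
Definition reduced t := let: (x, y, z) := t in
  [&& 2 * x <= y * z, 2 * y <= x * z & 2 * z <= x * y].

Lemma minimal_a_gt2 t : minimal_a t -> gt2 t.
Proof. by case: t => [[x y] z] /and4P[? ? ? _]; apply/and3P; split; lra. Qed.

Lemma minimal_a_reduced t : minimal_a t -> reduced t.
Proof. by case: t => [[x y] z] /and4P[? ? ? ?]; apply/and3P; split; nra. Qed.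

Lemma ascends_gt2 m x y z : gt2 m -> ascends m x y z -> [/\ 2 < x, 2 < y & 2 < z].
Proof.
move=> hm; elim=> [x1 y1 z1 e|? ? ? _ []|? ? ? _ []|x1 y1 z1 h _ [h1 h2 h3]] //.
  by move: hm; rewrite e => /and3P[].
by split=> //; nra.
Qed.

(* An ascending flip makes the flipped entry so large that flipping either of
   the other two is again ascending; flipping it back returns to the predecessor. *)
Lemma ascends_flips m x y z : gt2 m -> reduced m -> ascends m x y z ->
  [/\ ascends m x y (x * y - z), ascends m x (x * z - y) z
    & ascends m (y * z - x) y z].
Proof.
move=> hm hr h.
have flip2 a b c : ascends m a b c -> 2 * b <= a * c -> ascends m a (a * c - b) c.
  by move=> ha hb; apply/ascends_swap23/ascends_flip => //; apply: ascends_swap23.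
have flip1 a b c : ascends m a b c -> 2 * a <= b * c -> ascends m (b * c - a) b c.
  by move=> ha hb; apply/ascends_swap12/flip2 => //; apply: ascends_swap12.
elim: h => {x y z} [x y z e|x y z _ [h1 h2 h3]|x y z _ [h1 h2 h3]|x y z hle h [h1 h2 h3]].
- have h := ascends_root e; have /and3P[? ? ?] : reduced (x, y, z) by rewrite -e.
  by split; [apply: ascends_flip | apply: flip2 | apply: flip1].
- by rewrite (mulrC y); split; apply: ascends_swap12.
- by rewrite (mulrC z); split; apply: ascends_swap23.
- have [g1 g2 g3] := ascends_gt2 hm h1.
  by split; [rewrite subKr | apply: flip2 => //; nra | apply: flip1 => //; nra].
Qed.

Lemma ascends_reduced m x y z : ascends m x y z -> reduced (x, y, z) ->
  perm_eq [:: m.1.1; m.1.2; m.2] [:: x; y; z].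
Proof.
elim=> {x y z} [x y z -> _ //|x y z _ IH|x y z _ IH|x y z hle _ IH] /and3P[h1 h2 h3].
- have /IH/permPl -> : reduced (x, y, z) by rewrite /reduced (mulrC x y) h1 h2 h3.
  by apply/permP => a /=; rewrite addnCA.
- have /IH/permPl -> : reduced (x, y, z) by rewrite /reduced (mulrC y z) h1 h2 h3.
  by apply/permP => a /=; rewrite (addnCA (a y)).
(* The flip does not decrease [z], and flipping back does not decrease it either, so it is
   trivial. *)
- have e : x * y - z = z by lra.
  by rewrite e in h1 h2 *; apply: IH; apply/and3P.
Qed.

Lemma minimal_a_ascends m x y z :
  minimal_a m -> ascends m x y z -> minimal_a (x, y, z) -> (x, y, z) = m.
Proof.
move=> hm h ht; have := ascends_reduced h (minimal_a_reduced ht).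
case: m hm {h} => [[p q] r] /and4P[_ h1 h2 _]; case/and4P: ht => _ h3 h4 _ /=.
by move=> /le_sorted_eq; rewrite /= h1 h2 h3 h4 => /(_ isT isT) [-> -> ->].
Qed.

(* All flips are realized by Nielsen moves with the same representatives in
   [SL2], so no signs have to be tracked until the very end. *)
Lemma ascends_nielsen m (p q : PSL2 R * PSL2 R) : minimal_a m -> nielsen p q ->
  (exists u v, p = (\pi_(PSL2 R) u, \pi_(PSL2 R) v) /\
     ascends m (tr u) (tr v) (tr (u * v)%g)) ->
  exists u v, q = (\pi_(PSL2 R) u, \pi_(PSL2 R) v) /\
     ascends m (tr u) (tr v) (tr (u * v)%g).
Proof.
move=> hm; have hg := minimal_a_gt2 hm; have hr := minimal_a_reduced hm.
elim=> [_ _ [g h|g h|g h] [u [v [[-> ->] ha]]]|//|? ? ? _ h1 _ h2 /h1/h2//].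
- by exists v, u; rewrite trC; split=> //; apply: ascends_swap12.
- exists u^-1%g, v; rewrite pi_psl2_inv tr_inv tr_mulVl; split=> //.
  by have [] := ascends_flips hg hr ha.
- exists u, (v * u)%g; rewrite pi_psl2_mul; split=> //.
  rewrite mulgA (trC (u * v)%g) (trC v) tr_sqr_mul.
  by have [] := ascends_flips hg hr (ascends_swap23 ha).
Qed.

Lemma minimal_a_unique (U V U' V' : PSL2 R) t t' :
  nielsen (U, V) (U', V') -> trace_triple U V t -> minimal_a t ->
  trace_triple U' V' t' -> minimal_a t' -> t' = t.
Proof.
move=> hn [u [v [hu hv ht]]] hm [u' [v' [hu' hv' <-]]] hm'.
have [|u1 [v1 [[e1 e2] ha]]] := ascends_nielsen hm hn.
  exists u, v; rewrite hu hv -ht; split=> //.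
  exact: ascends_root.
have [g1 g2 _] := ascends_gt2 (minimal_a_gt2 hm) ha.
have /and3P[k1 k2 _] := minimal_a_gt2 hm'.
(* The two lifts of one class have opposite traces, so positivity settles the signs. *)
have eu : u' = u1 by apply: pi_eq_tr_gt0 _ (lt_trans _ k1) (lt_trans _ g1); rewrite ?hu'.
have ev : v' = v1 by apply: pi_eq_tr_gt0 _ (lt_trans _ k2) (lt_trans _ g2); rewrite ?hv'.
by subst; apply: minimal_a_ascends ha hm'.
Qed.

End Uniqueness.

(** * Feasibility of Step 2 and its consequences *)

Section Arranging.
Variable R : realType.
Implicit Types (x y z : R) (s t : R * R * R).

Local Notation arranges := (clos_refl_trans _ (@arrange_move R)).

Lemma arranges_step s t w : arrange_move s t -> arranges t w -> arranges s w.
Proof. by move=> h; apply/rt_trans/rt_step. Qed.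

Lemma arranges_norm_sorted s : exists x y z,
  arranges s (x, y, z) /\ (`|x| <= `|y|) && (`|y| <= `|z|).
Proof.
case: s => [[x y] z].
case: (leP `|x| `|y|) => hxy; case: (leP `|y| `|z|) => hyz;
  case: (leP `|x| `|z|) => hxz.
- exists x, y, z; split; first exact: rt_refl.
  by rewrite hxy hyz.
- by lra.
- exists x, z, y; split; first exact/rt_step/arrange_P2.
  by rewrite hxz ltW.
- exists z, x, y; split; last by rewrite hxy ltW.
  exact: arranges_step (arrange_P2 _ _ _) (rt_step _ _ _ _ (arrange_P1 _ _ _)).
- exists y, x, z; split; first exact/rt_step/arrange_P1.
  by rewrite hxz ltW.
- exists y, z, x; split; last by rewrite hyz ltW.
  exact: arranges_step (arrange_P1 _ _ _) (rt_step _ _ _ _ (arrange_P2 _ _ _)).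
- by lra.
- exists z, y, x; split; first exact/rt_step/arrange_P3.
  by rewrite !ltW.
Qed.

Lemma arranges_signs x y z : exists z',
  arranges (x, y, z) (`|x|, `|y|, z') /\ `|z'| = `|z|.
Proof.
case: (ger0P x) => _; case: (ger0P y) => _.
- by exists z; split=> //; apply: rt_refl.
- by exists (- z); rewrite normrN; split=> //; apply/rt_step/arrange_sign23.
- by exists (- z); rewrite normrN; split=> //; apply/rt_step/arrange_sign13.
- by exists z; split=> //; apply/rt_step/arrange_sign12.
Qed.

Definition norm_gt2 s := let: (x, y, z) := s in gt2 (`|x|, `|y|, `|z|).

Lemma arranges_norm_gt2 s t : arranges s t -> norm_gt2 s -> norm_gt2 t.
Proof.
elim=> [{}s {}t [] x y z /= /and3P[h1 h2 h3]|//|? ? ? _ h1 _ h2 /h1/h2//];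
  by rewrite ?normrN h1 h2 h3.
Qed.

Lemma step2_exists tau s : (tau < 2 -> norm_gt2 s) -> exists t, step2 tau s t.
Proof.
move=> hs; have [x [y [z [h1 hsort]]]] := arranges_norm_sorted s.
have [z' [h2 hz]] := arranges_signs x y z.
exists (`|x|, `|y|, z'); split; first exact: rt_trans h1 h2.
rewrite /arranged hz hsort andbT; case: ifP => // /hs.
by move=> /(arranges_norm_gt2 h1)/and3P[].
Qed.

(** The pairs [(u, v)], [(v, u)] and [(u * v, v^-1)] share the same [tau], and the hyperbolicity
    bound applies to the first entry of each. *)
Lemma traces_norm_gt2 (u v : SL2 R) : tau_of (traces u v) < 2 ->
  norm_gt2 (traces u v).
Proof.
move=> h; apply/and3P; split; first exact: hyperbolic_of_tau_lt2 h.
- apply: (@hyperbolic_of_tau_lt2 _ v u); move: h.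
  by rewrite /traces (trC v) /tau_of; lra.
- apply: (@hyperbolic_of_tau_lt2 _ (u * v)%g v^-1%g); move: h.
  by rewrite /traces mulgK tr_inv /tau_of; lra.
Qed.

(** For [z < 0] the term [- x * y * z] is positive, and [x, y > 2] would force [tau > 2]. *)
Lemma arranged_gt2 tau x y z : tau < 2 -> tau_of (x, y, z) = tau ->
  arranged tau (x, y, z) -> [/\ 2 < x, x <= y & y <= z].
Proof.
rewrite /arranged => ht htau; rewrite ht => /and3P[hx hxy hyz]; split=> //.
move: hyz; case: (ger0P z) => // hz hyz.
move: htau; rewrite /tau_of => htau.
have : x * y * z < 0 by rewrite pmulr_rlt0 // mulr_gt0; lra.
by nra.
Qed.

Lemma loop_terminates_arranged tau s : tau <> 2 -> tau_of s = tau ->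
  arranged tau s -> loop_terminates tau s.
Proof.
case: s => [[x y] z] hne htau harr; have [ht|ht] := ltP tau 2.
  by have [? ? ?] := arranged_gt2 ht htau harr; apply: loop_terminates_tau_lt2.
move: harr; rewrite /arranged ltNge ht /= => /and3P[hx hxy _].
by apply: loop_terminates_tau_gt2 => //; rewrite lt_neqAle ht andbT eq_sym; apply/eqP.
Qed.

End Arranging.

Theorem theorem3p5 (R : realType) (A B : PSL2 R) (a b : SL2 R)
    (ha : \pi_(PSL2 R) a = A) (hb : \pi_(PSL2 R) b = B)
    (ha0 : 0 <= tr a) (hb0 : 0 <= tr b)
    (tau : R) (htau : tau = tr (a * b * a^-1 * b^-1)%g) (htau2 : tau <> 2) :
  tma_terminates (traces a b) /\
  forall t : R * R * R, tma_returns (traces a b) t ->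
    [/\ exists U V : PSL2 R,
          [/\ generated A B U, generated A B V, nielsen (A, B) (U, V)
            & trace_triple U V t],
        tau < 2 -> minimal_a t,
        2 < tau -> minimal_b t
      & tau < 2 ->
          forall (U V : PSL2 R) (t' : R * R * R),
            nielsen (A, B) (U, V) -> trace_triple U V t' -> minimal_a t' ->
            t' = t].
Proof.
rewrite tr_commutator in htau.
rewrite /tma_terminates /tma_returns -htau; split.
  split=> [|s hs].
    by apply: step2_exists => ht; apply: traces_norm_gt2; rewrite -htau.
  case: (hs) => _ harr; apply: loop_terminates_arranged => //.
  by rewrite (tau_step2 hs).
move=> t [s [t1 [hs hloop ht]]].
have [u [v [hn htr]]] : realized A B t.
  rewrite ht; apply/realized_step4/(realized_loop hloop)/(realized_step2 hs).
  by exists a, b; rewrite ha hb; split=> //; apply: rt_refl.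
have hrt : trace_triple (\pi_(PSL2 R) u) (\pi_(PSL2 R) v) t by exists u, v.
have hta : tau < 2 -> minimal_a t.
  move=> hlt; have hts := tau_step2 hs; rewrite -htau in hts.
  have -> : t = t1 by rewrite ht /step4; case: t1 {hloop ht} => [[? ?] ?]; rewrite hlt.
  apply: (loop_returns_minimal_a hloop) => //; case: hs => _.
  case: s hts {hloop} => [[x y] z] hts /(arranged_gt2 hlt hts)[? ? ?].
  by apply/and3P; split; lra.
split=> //.
- exists (\pi_(PSL2 R) u), (\pi_(PSL2 R) v).
  have [] := @nielsen_generated _ A B _ _ hn; last by split.
  by split; [apply: generated_l | apply: generated_r].
- move=> hgt; have hge : ~~ (tau < 2) by rewrite -leNgt ltW.
  rewrite ht; apply: (loop_returns_minimal_b hloop) => //; case: hs => _.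
  case: s {hloop} => [[x y] z]; rewrite /arranged (negbTE hge).
  by case/and3P => -> ->.
- move=> hlt U V t' hn' htr' hm'.
  (* The pair [(U, V)] is compared with the pair found by the algorithm through [(A, B)]. *)
  apply: minimal_a_unique hrt (hta hlt) htr' hm'.
  exact: nielsen_trans (nielsen_sym hn) hn'.
Qed.
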